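(* Let $k$ be a positive integer and let $V_1\subseteq D_{int}$ be a set of stops. Then every point of $D_{edge}$ is within $\ell_1$ distance $k$ of some point of $V_1$ if and only if every point of $D$ is within $\ell_1$ distance $k$ of some point of $V_1$.
   Context: Let $m\ge n\ge 1$ be integers, $D=\{(x,y)\in\mathbb{R}^2: 0\le x\le n,\ 0\le y\le m\}$, $D_{int}=D\cap\mathbb{Z}^2$ and $D_{edge}=\{(x,y)\in D: x\in\mathbb{Z}\text{ or }y\in\mathbb{Z}\}$. *)

(* Defs.v *)
From HB Require Import structures.
From mathcomp Require Import all_boot all_order all_algebra.
From mathcomp Require Import boolp classical_sets reals.

Set Implicit Arguments.
Unset Strict Implicit.
Unset Printing Implicit Defensive.

Import Order.TTheory GRing.Theory Num.Theory.

Local Open Scope classical_set_scope.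
Local Open Scope ring_scope.

Definition l1dist (R : realType) (p q : R * R) : R :=
  `|p.1 - q.1| + `|p.2 - q.2|.

(* Beware the argument order: the height m comes before the width n. *)
Definition D (R : realType) (m n : nat) : set (R * R) :=
  [set p | 0 <= p.1 <= n%:R /\ 0 <= p.2 <= m%:R].

Definition Dint (R : realType) (m n : nat) : set (R * R) :=
  D m n `&` [set p | p.1 \is a Num.int /\ p.2 \is a Num.int].

Definition Dedge (R : realType) (m n : nat) : set (R * R) :=
  D m n `&` [set p | p.1 \is a Num.int \/ p.2 \is a Num.int].

Definition l1_covers (R : realType) (k : nat) (V A : set (R * R)) : Prop :=
  forall p, A p -> exists2 v, V v & l1dist p v <= k%:R.

(* Main.v *)
(* For a point p of an open unit cell, let q be the midpoint of a nearest side of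
   the cell.  A lattice point is at half-integral distance from q, so distance at
   most k is in fact at most k - 1/2; this slack of 1/2 is just enough to replace
   q by p. *)
Require Import Defs.
From HB Require Import structures.
From mathcomp Require Import all_boot all_order all_algebra.
From mathcomp Require Import boolp classical_sets reals.
From mathcomp Require Import lra.

Set Implicit Arguments.
Unset Strict Implicit.
Unset Printing Implicit Defensive.

Import Order.TTheory GRing.Theory Num.Theory.

Local Open Scope classical_set_scope.
Local Open Scope ring_scope.

Lemma l1dist_swap (R : realType) (p q : R * R) :
  l1dist (p.2, p.1) (q.2, q.1) = l1dist p q.
Proof. by rewrite /l1dist addrC. Qed.

Lemma int_lerD1 (R : archiRealDomainType) (u v : R) :
  u \is a Num.int -> v \is a Num.int -> (u + 1 <= v) = (u < v).
Proof.
by move=> /intrP[i ->] /intrP[j ->]; rewrite -(intrD _ i 1) ler_int ltr_int lezD1.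
Qed.

(** The two bounds on [|p.1 - a|] say that [p] is no farther from the line of the vertical side from
    [(a, b)] to [(a, b + 1)] than from the horizontal lines through its ends, i.e. that [p] lies
    within [l1dist] 1/2 of its midpoint. *)
Lemma l1dist_of_midpoint (R : realType) (a b : R) (k : nat) (p v : R * R) :
  a \is a Num.int -> b \is a Num.int ->
  v.1 \is a Num.int -> v.2 \is a Num.int ->
  `|p.1 - a| <= p.2 - b -> `|p.1 - a| <= b + 1 - p.2 ->
  l1dist (a, b + 2^-1) v <= k%:R -> l1dist p v <= k%:R.
Proof.
case: p v => [s t] [x y] /= aZ bZ xZ yZ hlo hhi; rewrite /l1dist /= => hk.
have kZ : (k%:R : R) \is a Num.int by exact: natr_int.
have axZ : `|a - x| \is a Num.int by apply/intr_nat/natr_norm_int; exact: rpredB.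
have tri : `|s - x| <= `|s - a| + `|a - x| by exact: ler_distD.
have [leyb|ltby] := lerP y b.
- have yb : `|b + 2^-1 - y| = b + 2^-1 - y by rewrite ger0_norm; lra.
  (* The integer [|a - x| + (b - y)] is at most [k - 1/2], hence strictly below the integer [k],
     hence at most [k - 1]. *)
  have : `|a - x| + (b - y) + 1 <= k%:R.
    by rewrite int_lerD1 ?rpredD ?rpredN ?rpred1//; lra.
  have -> : `|t - y| = t - y by rewrite ger0_norm; move: (normr_ge0 (s - a)); lra.
  lra.
(* No lattice height lies strictly between the ends of the side, so here [y] is above the whole side
   and the first case is mirrored. *)
- have leby : b + 1 <= y by rewrite int_lerD1.
  have yb : `|b + 2^-1 - y| = y - b - 2^-1 by rewrite ler0_norm; lra.
  have : `|a - x| + (y - b - 1) + 1 <= k%:R.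
    by rewrite int_lerD1 ?rpredD ?rpredN ?rpred1//; lra.
  have -> : `|t - y| = y - t by rewrite ler0_norm; move: (normr_ge0 (s - a)); lra.
  lra.
Qed.

(** The integer part of [x] serves as [i]. As [x] is not an integer, it differs from [i] and from
    [n]; then [i <= x < n] leaves room for a whole cell. *)
Lemma nonint_between_nats (R : realType) (n : nat) (x : R) :
  0 <= x <= n%:R -> x \isn't a Num.int ->
  exists i : nat, [/\ i%:R < x, x < i%:R + 1 & (i%:R + 1 <= n%:R :> R)].
Proof.
move=> /andP[x0 xn] xZ; exists (Num.truncn x).
have /andP[lex ltx] := truncn_itv x0.
rewrite natr1; split=> //.
- rewrite lt_neqAle lex andbT; apply: contraNneq xZ => <-; exact: natr_int.
- by rewrite ler_nat -(ltr_nat R) (le_lt_trans lex)// lt_neqAle xn andbT;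
    apply: contraNneq xZ => ->; exact: natr_int.
Qed.

Theorem proposition2 (R : realType) (m n : nat) (hn : (1 <= n)%N)
    (hmn : (n <= m)%N) (k : nat) (hk : (0 < k)%N)
    (V1 : set (R * R)) (hV1 : V1 `<=` Dint m n) :
  l1_covers k V1 (Dedge m n) <-> l1_covers k V1 (D m n).
Proof.
split=> cov p; last by case=> pD _; exact: cov.
move=> pD; have [xZ|xZ] := boolP (p.1 \is a Num.int).
  by apply: cov; split=> //; left.
have [yZ|yZ] := boolP (p.2 \is a Num.int).
  by apply: cov; split=> //; right.
case: pD => px py.
have [i [ix xi iN]] := nonint_between_nats px xZ.
have [j [jy yj jM]] := nonint_between_nats py yZ.
have i0 : 0 <= i%:R :> R by exact: ler0n.
have j0 : 0 <= j%:R :> R by exact: ler0n.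
have iZ : (i%:R : R) \is a Num.int by exact: natr_int.
have jZ : (j%:R : R) \is a Num.int by exact: natr_int.
(* The side lies on the line of abscissa [a], later [i] or [i + 1]; its midpoint is in [Dedge]
   because [j + 1 <= m]. *)
have vertical a : a \is a Num.int -> 0 <= a <= n%:R ->
    `|p.1 - a| <= p.2 - j%:R -> `|p.1 - a| <= j%:R + 1 - p.2 ->
    exists2 v, V1 v & l1dist p v <= k%:R.
  move=> aZ an h1 h2; have [|v Vv qv] := cov (a, j%:R + 2^-1).
    by split; [split=> //=; lra|left].
  have [_ [v1Z v2Z]] := hV1 _ Vv.
  by exists v => //; exact: (l1dist_of_midpoint aZ jZ).
have horizontal b : b \is a Num.int -> 0 <= b <= m%:R ->
    `|p.2 - b| <= p.1 - i%:R -> `|p.2 - b| <= i%:R + 1 - p.1 ->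
    exists2 v, V1 v & l1dist p v <= k%:R.
  move=> bZ bm h1 h2; have [|v Vv qv] := cov (i%:R + 2^-1, b).
    by split; [split=> //=; lra|right].
  have [_ [v1Z v2Z]] := hV1 _ Vv.
  (* Exchanging the coordinates turns the horizontal side into a vertical one. *)
  exists v => //; rewrite -l1dist_swap.
  by apply: (l1dist_of_midpoint bZ iZ) => //; rewrite -l1dist_swap.
(* The two diagonals cut the cell into four triangles, one per nearest side: left, bottom, top,
   right in the order of the cases. *)
have [ant|ant] := lerP (p.1 - i%:R + (p.2 - j%:R)) 1;
  have [dia|dia] := lerP (p.1 - i%:R) (p.2 - j%:R).
- by apply: (vertical i%:R) => //; rewrite ?ger0_norm; lra.
- by apply: (horizontal j%:R) => //; rewrite ?ger0_norm; lra.
- by apply: (horizontal (j%:R + 1)); rewrite ?rpredD ?rpred1 ?ler0_norm//; lra.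
- by apply: (vertical (i%:R + 1)); rewrite ?rpredD ?rpred1 ?ler0_norm//; lra.
Qed.
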